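(* Let $\Gamma$ be a connected regular graph on $v$ vertices, with adjacency algebra $\mathcal{A}$, and let $m\ge1$ be an integer. Then $\mathcal{A}$ contains a matrix $K$ that is permutation-similar to $I_{m+1}\otimes J_{v/(m+1)}$ (so in particular $m+1$ divides $v$) if and only if there is an idempotent $E\in\mathcal{A}$ of rank $m$ such that $EJ=O$ and $\dim\langle J,E\rangle^\circ=2$. Moreover, if so, then the distinct columns of $K$ are the characteristic vectors of the cells of an equitable partition of $\Gamma$ into $m+1$ parts of equal size.
   Context: Graphs are finite, simple and undirected. The adjacency algebra $\mathcal{A}$ of $\Gamma$ is the real vector space of all polynomials in its $01$-adjacency matrix $A$. Idempotent means $E^2=E$ for the ordinary matrix product. $J$ (or $J_n$) is the all-ones matrix, $O$ the zero matrix, and $\circ$ the entrywise product. For a matrix $E$, $\langle J,E\rangle^\circ$ is the real vector space spanned by $J,E,E\circ E,E\circ E\circ E,\dots$. Two square matrices $A,B$ are permutation-similar if $B=P^\top AP$ for some permutation matrix $P$. A partition $\{\mathcal{P}_0,\dots,\mathcal{P}_s\}$ of the vertex set is equitable if for all $i,j$ the number of neighbors in $\mathcal{P}_j$ of a vertex $x\in\mathcal{P}_i$ depends only on $i$ and $j$, not on $x$. *)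

(* Defs.v *)
From HB Require Import structures.
From mathcomp Require Import all_boot all_order all_algebra.
From mathcomp Require Import reals.
From mathcomp Require Export mxtens.

Set Implicit Arguments.
Unset Strict Implicit.
Unset Printing Implicit Defensive.

Import GRing.Theory.
Local Open Scope ring_scope.

(* A finite simple undirected graph on v vertices is given by its adjacency
   relation e : rel 'I_v, subject to simple_graph. *)
Definition simple_graph (v : nat) (e : rel 'I_v) : Prop :=
  symmetric e /\ irreflexive e.

(* The graph with no vertex is not connected. *)
Definition connected_graph (v : nat) (e : rel 'I_v) : Prop :=
  (0 < v)%N /\ forall x y : 'I_v, connect e x y.

Definition regular_graph (v : nat) (e : rel 'I_v) : Prop :=
  exists k : nat, forall x : 'I_v, #|[set y | e x y]| = k.

Definition adjmx (R : realType) (v : nat) (e : rel 'I_v) : 'M[R]_v :=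
  \matrix_(x, y) (e x y)%:R.

Definition in_adjacency_algebra (R : realType) (v : nat) (e : rel 'I_v)
    (M : 'M[R]_v) : Prop :=
  exists p : {poly R}, M = \sum_(i < size p) p`_i *: adjmx R e ^+ i.

Definition allones (R : realType) (n : nat) : 'M[R]_n := const_mx 1.

Definition schur (R : realType) (n : nat) (A B : 'M[R]_n) : 'M[R]_n :=
  map2_mx *%R A B.

(* The sequence J, E, E o E, E o E o E, ... *)
Definition schur_power (R : realType) (n : nat) (E : 'M[R]_n) (k : nat) :
    'M[R]_n :=
  iter k (schur E) (allones R n).

Definition in_family_span (K : fieldType) (V : vectType K) (F : nat -> V)
    (x : V) : Prop :=
  exists n : nat, x \in <<mkseq F n>>%VS.

Definition has_dim (K : fieldType) (V : vectType K) (S : V -> Prop)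
    (d : nat) : Prop :=
  exists2 U : {vspace V}, (forall x : V, x \in U <-> S x) & \dim U = d.

Definition perm_similar (R : realType) (n : nat) (A B : 'M[R]_n) : Prop :=
  exists2 P : 'M[R]_n, is_perm_mx P & B = P^T *m A *m P.

(* K is permutation-similar to the Kronecker product of I_k and J_(v/k);
   the size equation v_eq says that k divides v and is only used for the
   type cast. *)
Definition similar_to_block_ones (R : realType) (v k : nat) (K : 'M[R]_v) :
    Prop :=
  exists v_eq : (k * (v %/ k))%N = v,
    perm_similar K
      (castmx (v_eq, v_eq) ((1%:M : 'M[R]_k) *t allones R (v %/ k))).

Definition equitable (v : nat) (e : rel 'I_v) (P : {set {set 'I_v}}) : Prop :=
  partition P [set: 'I_v] /\
  forall C D : {set 'I_v}, C \in P -> D \in P ->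
    forall x y : 'I_v, x \in C -> y \in C ->
      #|[set z in D | e x z]| = #|[set z in D | e y z]|.

Definition char_vec (R : realType) (v : nat) (C : {set 'I_v}) : 'cV[R]_v :=
  \col_x (x \in C)%:R.

(* Main.v *)
(* A matrix permutation-similar to [I_(m+1) (x) J_s] is the same as the 0/1 matrix
   of an equivalence relation with [m+1] classes of size [s].  Connectedness and
   regularity put [J] in the adjacency algebra (Hoffman), so one passes between
   [K] and [E] by [E = K / s - J / v].  Conversely, [dim <J, E> = 2] says that [E]
   has exactly two distinct entries [a] and [b]; [EJ = O] and [E^2 = E] force a
   constant diagonal, say [a], so that entry [a] at [(x, y)] means that rows [x]
   and [y], which have squared norm [a] and inner product [a], coincide.  The
   trace and row sums then give [v = (m+1) s].  The partition into classes is
   equitable because [K] commutes with [A]. *)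
Require Import Defs.
From mathcomp Require Import all_boot all_order all_algebra.
From mathcomp Require Import fingroup perm.
From mathcomp Require Import reals.
From mathcomp Require Import ring lra.

Set Implicit Arguments.
Unset Strict Implicit.
Unset Printing Implicit Defensive.

Import Order.TTheory GRing.Theory Num.Theory.
Local Open Scope ring_scope.

(** * Partitions into fibres of equal size *)

Definition fibres (T : finType) (rT : eqType) (f : T -> rT) : {set {set T}} :=
  [set [set y | f x == f y] | x in [set: T]].

Lemma fibres_partition (T : finType) (rT : eqType) (f : T -> rT) :
  partition (fibres f) [set: T].
Proof.
have -> : fibres f = preim_partition f [set: T].
  apply: eq_in_imset => x _; apply/setP => y.
  by rewrite !inE.
exact: preim_partitionP.
Qed.

Lemma card_fibres (T : finType) (rT : eqType) (f : T -> rT) (s : nat) :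
  (forall x, #|[set y | f x == f y]| = s) -> #|T| = (#|fibres f| * s)%N.
Proof.
move=> fib; rewrite -cardsT.
apply: card_uniform_partition (fibres_partition f).
by move=> _ /imsetP[x _ ->].
Qed.

Lemma card_fibres_eq (T : finType) (rT : eqType) (f : T -> rT) (k s : nat) :
  (0 < #|T|)%N -> (forall x, #|[set y | f x == f y]| = s) ->
  #|T| = (k * s)%N -> #|fibres f| = k.
Proof.
move=> T_gt0 fib cardT; have := card_fibres fib; move: (T_gt0).
rewrite cardT muln_gt0 => /andP[_ s_gt0] /eqP.
by rewrite eqn_pmul2r // => /eqP.
Qed.

(** The values of [f] may be of any kind, such as rows of a matrix. As there are exactly [k] fibres,
    enumerating them gives labels in ['I_k]. *)
Lemma fibre_labels (T : finType) (rT : eqType) (f : T -> rT) (k s : nat) :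
  (0 < #|T|)%N -> (forall x, #|[set y | f x == f y]| = s) ->
  #|T| = (k * s)%N ->
  exists2 g : T -> 'I_k, forall x y, (g x == g y) = (f x == f y) &
    forall c, #|[set x | g x == c]| = s.
Proof.
move=> T_gt0 fib cardT; have cardF := card_fibres_eq T_gt0 fib cardT.
have /card_gt0P[x0 _] := T_gt0.
have inF x : [set y | f x == f y] \in fibres f by apply: imset_f.
pose g x := cast_ord cardF (enum_rank_in (inF x0) [set y | f x == f y]).
have gE x y : (g x == g y) = (f x == f y).
  rewrite (inj_eq (@cast_ord_inj _ _ _)).
  rewrite (inj_in_eq (can_in_inj (enum_rankK_in (inF x0)))) ?inF //.
  apply/eqP/eqP => [/setP/(_ y) | fxy]; first by rewrite !inE eqxx => /eqP.
  by apply/setP => z; rewrite !inE fxy.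
exists g => // c; have := enum_valP (cast_ord (esym cardF) c).
case/imsetP => x _ eq_c; rewrite -(fib x); apply: eq_card => y.
have -> : c = g x.
  by rewrite /g -eq_c enum_valK_in cast_ordKV.
by rewrite !inE gE eq_sym.
Qed.

(** * Matrices of equivalence relations; the trace of an idempotent *)

Definition fibre_mx (R : pzRingType) (v : nat) (T : eqType) (f : 'I_v -> T) :
  'M[R]_v := \matrix_(x, y) (f x == f y)%:R.

Lemma sum_indicator (R : pzRingType) (T : finType) (P : pred T) :
  \sum_x (P x)%:R = #|[set x | P x]|%:R :> R.
Proof.
rewrite -natr_sum -sum1_card big_mkcond /=; congr _%:R.
rewrite [RHS]big_mkcond /=; apply: eq_bigr => x _.
by rewrite inE; case: (P x).
Qed.

Section FibreMatrix.

Variables (R : realType) (v s : nat) (T : eqType) (f : 'I_v -> T).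
Hypothesis fib : forall x, #|[set y | f x == f y]| = s.

(** The entry at [(x, y)] counts the [z] lying in the fibres of both [x] and [y]: [s] of them if the
    two fibres coincide, none otherwise. *)
Lemma fibre_mx_sqr : fibre_mx R f *m fibre_mx R f = s%:R *: fibre_mx R f.
Proof.
apply/matrixP => x y; rewrite !mxE.
transitivity (\sum_z ((f x == f z)%:R * (f x == f y)%:R : R)).
  apply: eq_bigr => z _; rewrite !mxE.
  by have [->|_] := eqVneq (f x) (f z); rewrite ?mul0r.
by rewrite -mulr_suml sum_indicator fib.
Qed.

Lemma fibre_mx_allones : fibre_mx R f *m allones R v = s%:R *: allones R v.
Proof.
apply/matrixP => x y; rewrite !mxE mulr1 -[s in RHS](fib x) -sum_indicator.
by apply: eq_bigr => z _; rewrite !mxE mulr1.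
Qed.

Lemma allones_fibre_mx : allones R v *m fibre_mx R f = s%:R *: allones R v.
Proof.
have trK : (fibre_mx R f)^T = fibre_mx R f.
  by apply/matrixP => x y; rewrite !mxE eq_sym.
have trJ : (allones R v)^T = allones R v by rewrite trmx_const.
by apply: trmx_inj; rewrite trmx_mul trK trJ fibre_mx_allones linearZ /= trJ.
Qed.

End FibreMatrix.

(** A vertex corresponds to the pair of its block and its position there. Forgetting the position
    leaves the labelling [g]; conversely, enumerating each block yields a permutation. *)
Lemma similar_to_block_onesP (R : realType) (v k : nat) (K : 'M[R]_v) :
  similar_to_block_ones k K <->
  (k * (v %/ k))%N = v /\
  exists2 g : 'I_v -> 'I_k,
    forall c, #|[set x | g x == c]| = (v %/ k)%N & K = fibre_mx R g.
Proof.
set t := (v %/ k)%N; split=> [[v_eq [P /is_perm_mxP[s ->]]]|[v_eq [g fib KE]]].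
  (* Conjugation by a permutation matrix reindexes rows and columns, so [K x y] is the entry of the
     block matrix at [(s x, s y)]. *)
  rewrite tr_perm_mx -{2}[s]invgK -mulmxA -col_permE -row_permE => KE.
  split=> //; pose u x := mxtens_unindex (cast_ord (esym v_eq) (s x)).
  exists (fun x => (u x).1) => [c|]; last first.
    apply/matrixP => x y; move/matrixP/(_ (s x) (s y)): KE.
    rewrite [X in _ = X]mxE [X in _ = X]mxE !permK => <-.
    by rewrite castmxE !mxE mulr1.
  pose h (j : 'I_t) := (s^-1)%g (cast_ord v_eq (mxtens_index (c, j))).
  have h_inj : injective h.
    move=> i j /perm_inj/cast_ord_inj/(can_inj (@mxtens_indexK _ _)).
    by case.
  rewrite -[RHS](card_ord t) -[RHS]cardsT -(card_imset _ h_inj).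
  apply: eq_card => x; rewrite inE; apply/eqP/imsetP => [ux|[j _ ->]].
    exists (u x).2 => //; rewrite /h -ux -surjective_pairing.
    by rewrite mxtens_unindexK cast_ordKV permK.
  by rewrite /u /h permKV cast_ordK mxtens_indexK.
(* The position of [x] in the enumeration of its own block serves as second coordinate. *)
have ltx x : (index x (enum [set y | g y == g x]) < t)%N.
  by rewrite -(fib (g x)) cardE index_mem mem_enum inE.
pose u x := cast_ord v_eq (mxtens_index (g x, Ordinal (ltx x))).
have u_inj : injective u.
  move=> x y /cast_ord_inj/(can_inj (@mxtens_indexK _ _))[gxy].
  by rewrite gxy => /(index_inj x); apply; rewrite mem_enum inE ?gxy.
exists v_eq; exists (perm_mx (perm u_inj)); first exact: perm_mx_is_perm.
rewrite tr_perm_mx -{2}[perm u_inj]invgK -mulmxA -col_permE -row_permE.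
apply/matrixP => i j; rewrite castmxE [RHS]mxE [RHS]mxE KE [RHS]mxE.
rewrite -{1}[i](permKV (perm u_inj)) -{1}[j](permKV (perm u_inj)).
by rewrite !permE /u !cast_ordK tensmxE !mxE mulr1.
Qed.

(** In a full-rank factorization [E = C B], [E E = E] reads [C (B C) B = C B]. Cancelling [C] and
    [B] gives [B C = 1], of size the rank, and [B C] has the same trace as [C B]. *)
Lemma idempotent_rank (F : fieldType) (n : nat) (E : 'M[F]_n) :
  E *m E = E -> \tr E = (\rank E)%:R.
Proof.
move=> EE; rewrite -{1}(mulmx_base E) mxtrace_mulC.
suff -> : row_base E *m col_base E = 1%:M by rewrite mxtrace1.
apply: (row_free_inj (row_base_free E)).
apply: (row_full_inj (col_base_full E)).
by rewrite mul1mx -mulmxA mulmx_base mulmxA mulmx_base EE.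
Qed.


(** * The adjacency algebra, and Hoffman's theorem that it contains [J] *)

Section AdjacencyAlgebra.

Variables (R : realType) (n : nat) (e : rel 'I_n.+1).
Implicit Types M N : 'M[R]_n.+1.

Lemma in_adjacency_algebraP M :
  in_adjacency_algebra e M <-> exists p, M = horner_mx (adjmx R e) p.
Proof.
have hornerE p : horner_mx (adjmx R e) p =
    \sum_(i < size p) p`_i *: adjmx R e ^+ i.
  rewrite -{1}(coefK p) poly_def rmorph_sum; apply: eq_bigr => i _.
  by rewrite /= horner_mxZ rmorphXn /= horner_mx_X.
by split=> -[p ->]; exists p; rewrite hornerE.
Qed.

Lemma in_adjacency_algebra_lin a b M N :
  in_adjacency_algebra e M -> in_adjacency_algebra e N ->
  in_adjacency_algebra e (a *: M + b *: N).
Proof.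
move=> /in_adjacency_algebraP[p ->] /in_adjacency_algebraP[q ->].
by apply/in_adjacency_algebraP; exists (a *: p + b *: q); rewrite rmorphD /= !horner_mxZ.
Qed.

Lemma in_adjacency_algebra_comm M :
  in_adjacency_algebra e M -> adjmx R e *m M = M *m adjmx R e.
Proof. by case/in_adjacency_algebraP=> p ->; apply: comm_mx_horner. Qed.

Hypothesis e_sym : symmetric e.

Lemma adjmx_tr : (adjmx R e)^T = adjmx R e.
Proof. by apply/matrixP => x y; rewrite !mxE e_sym. Qed.

Lemma in_adjacency_algebra_tr M : in_adjacency_algebra e M -> M^T = M.
Proof.
case/in_adjacency_algebraP=> p ->.
elim/poly_ind: p => [|p c IHp]; first by rewrite rmorph0 trmx0.
rewrite rmorphD rmorphM /= horner_mx_X horner_mx_C linearD /= tr_scalar_mx.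
rewrite [in LHS]trmx_mul IHp adjmx_tr; congr (_ + _).
exact: comm_mx_horner.
Qed.

(* A maximum point of [f] has only maximum points as neighbours. *)
Lemma harmonic_const (f : 'I_n.+1 -> R) (k : nat) :
  (forall x y, connect e x y) -> (forall x, #|[set y | e x y]| = k) ->
  (forall x, \sum_(y | e x y) f y = k%:R * f x) -> forall x y, f x = f y.
Proof.
move=> e_conn e_reg f_harm.
pose x0 := [arg max_(x > ord0 | true) f x]%O.
have f_max y : f y <= f x0.
  by rewrite /x0; case: Order.TotalTheory.arg_maxP => //= x _; apply.
suff fE y : f y = f x0 by move=> x y; rewrite !fE.
have /connectP[p e_p ->] := e_conn x0 y.
suff fE x : path e x p -> f x = f x0 -> f (last x p) = f x0 by apply: fE.
elim: p x {e_p} => //= z p IHp x /andP[exz e_p] fx.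
apply: IHp => //; apply/eqP; rewrite -subr_eq0 -oppr_eq0 opprB; apply/eqP.
(* The nonnegative differences [f x0 - f y] over the neighbours [y] of [x] sum to
   [k * f x0 - k * f x = 0], so each vanishes. *)
apply: (@psumr_eq0P _ _ (e x) (fun y => f x0 - f y)) exz => [t _|].
  by rewrite subr_ge0.
rewrite sumrB f_harm fx sumr_const -[#|_|]cardsE e_reg.
by rewrite mulr_natl subrr.
Qed.

(* If [q] is the cofactor of ['X - k] in the minimal polynomial, then [q(A)] is
   nonzero and its rows lie in the eigenspace of [k], hence are constant; being
   symmetric, [q(A)] is a multiple of [J]. *)
Lemma allones_in_adjacency_algebra :
  connected_graph e -> regular_graph e -> in_adjacency_algebra e (allones R n.+1).
Proof.
move=> [_ e_conn] [k e_reg]; set A := adjmx R e.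
have k_eig : eigenvalue A k%:R.
  apply/eigenvalueP; exists (const_mx 1 : 'rV_n.+1).
    apply/rowP => y; rewrite !mxE mulr1 -(e_reg y) -sum_indicator.
    by apply: eq_bigr => x _; rewrite !mxE mul1r e_sym.
  by apply/eqP => /rowP/(_ ord0); rewrite !mxE => /eqP; rewrite oner_eq0.
have p_neq0 : mxminpoly A != 0 by rewrite monic_neq0 ?mxminpoly_monic.
move: (k_eig); rewrite eigenvalue_root_min -dvdp_XsubCl.
case/dvdpP=> q pE; set M := horner_mx A q.
have M_neq0 : M != 0.
  (* [q] is nonzero of smaller degree than the minimal polynomial, so it cannot annihilate [A]. *)
  apply/eqP => /mxminpoly_min /dvdp_leq; rewrite pE.
  have q_neq0 : q != 0 by apply: contraNneq p_neq0; rewrite pE => ->; rewrite mul0r.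
  by rewrite size_mul ?polyXsubC_eq0 // size_XsubC addn2 ltnn => /(_ q_neq0).
have M_alg : in_adjacency_algebra e M by apply/in_adjacency_algebraP; exists q.
have MA : M *m A = k%:R *: M.
  apply/eqP; rewrite -subr_eq0 -mul_mx_scalar -mulmxBr.
  have := mx_root_minpoly A; rewrite pE rmorphM rmorphB /=.
  by rewrite horner_mx_X horner_mx_C => /eqP.
have M_sym := in_adjacency_algebra_tr M_alg.
have M_row x y z : M x y = M x z.
  apply: (@harmonic_const (M x) k) => // {}y.
  move/matrixP/(_ x y): MA; rewrite [X in _ = X]mxE => <-.
  rewrite mxE big_mkcond /=; apply: eq_bigr => t _; rewrite mxE e_sym.
  by case: ifP; rewrite ?mulr1 ?mulr0.
have ME : M = M ord0 ord0 *: allones R n.+1.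
  apply/matrixP => x y; rewrite [RHS]mxE [allones _ _ _ _]mxE mulr1.
  by rewrite (M_row _ _ ord0) -[in LHS]M_sym mxE (M_row _ _ ord0).
have c_neq0 : M ord0 ord0 != 0.
  by apply: contraNneq M_neq0 => c0; rewrite ME c0 scale0r.
have -> : allones R n.+1 = (M ord0 ord0)^-1 *: M + 0 *: M.
  by rewrite scale0r addr0 {2}ME scalerA mulVf ?scale1r.
exact: in_adjacency_algebra_lin.
Qed.

End AdjacencyAlgebra.

(** * Entrywise powers and matrices with two distinct entries *)

Lemma schur_powerE (R : realType) (n k : nat) (E : 'M[R]_n) x y :
  schur_power E k x y = E x y ^+ k.
Proof.
elim: k => [|k IHk]; first by rewrite /schur_power /= mxE.
by rewrite /schur_power iterS mxE IHk exprS.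
Qed.

Section TwoValued.

Variables (R : realType) (n : nat) (E : 'M[R]_n.+1).
Let J : 'M[R]_n.+1 := allones R n.+1.

Lemma mem_schur_span (k : nat) : in_family_span (schur_power E) (schur_power E k).
Proof.
exists k.+1; apply: memv_span; apply/mapP; exists k => //.
by rewrite mem_iota add0n ltnS /=.
Qed.

Lemma schur_power0 : schur_power E 0 = J. Proof. by []. Qed.

Lemma schur_power1 : schur_power E 1 = E.
Proof. by apply/matrixP => x y; rewrite schur_powerE. Qed.

(** In dimension 2, [J] and [E] form a basis, so the entrywise square of [E] is a combination of
    them and all entries are roots of one quadratic. Conversely, on two values every power agrees
    with an affine function. *)
Lemma schur_span_dim2P :
  has_dim (in_family_span (schur_power E)) 2 <->
  exists a b, [/\ a != b, exists x y, E x y = a, exists x y, E x y = b &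
    forall x y, E x y = a \/ E x y = b].
Proof.
have J_neq0 : J != 0.
  by apply/eqP => /matrixP/(_ ord0 ord0)/eqP; rewrite !mxE oner_eq0.
split=> [[U UP dimU]|[a [b [ab [xa [ya Ea]] [xb [yb Eb]] Eab]]]]; last first.
  have EJ : E \notin <[J]>%VS.
    apply/vlineP => -[c Ec]; move/negP: ab; apply; rewrite -Ea -Eb Ec.
    by rewrite !mxE.
  exists <<[:: E; J]>>%VS; last first.
    suff /eqP: free [:: E; J] by [].
    by rewrite free_cons span_seq1 EJ seq1_free.
  move=> M; split=> [MU|[k]]; first exists 2%N.
    move: M MU; apply/subvP/span_subvP => M; rewrite !inE => /orP[]/eqP->.
      by rewrite -{1}schur_power1; apply: memv_span; rewrite !inE eqxx orbT.
    by rewrite -{1}schur_power0; apply: memv_span; rewrite !inE eqxx.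
  move: M; apply/subvP/span_subvP => _ /mapP[i _ ->].
  (* Slope of the affine function through [(a, a ^+ i)] and [(b, b ^+ i)]. *)
  pose c := (b ^+ i - a ^+ i) / (b - a).
  have -> : schur_power E i = c *: E + (a ^+ i - c * a) *: J.
    apply/matrixP => x y; rewrite schur_powerE !mxE mulr1.
    have ba : b - a != 0 by rewrite subr_eq0 eq_sym.
    by case: (Eab x y) => ->; rewrite /c; field.
  rewrite memvD // memvZ // memv_span // !inE eqxx ?orbT //.
have inU k : schur_power E k \in U by apply/UP/mem_schur_span.
(* Otherwise every entrywise power is a multiple of [J] and the dimension is at most 1. *)
have EJ : E \notin <[J]>%VS.
  apply/vlineP => -[c Ec]; have : (U <= <[J]>)%VS.
    apply/subvP => M /UP[k]; move: M; apply/subvP/span_subvP => _ /mapP[i _ ->].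
    apply/vlineP; exists (c ^+ i); apply/matrixP => x y.
    by rewrite schur_powerE Ec !mxE !mulr1.
  by move/dimvS; rewrite dimU dim_vline; case: (J != 0).
have UE : U = <<[:: E; J]>>%VS.
  apply/esym/eqP; rewrite eqEdim dimU; apply/andP; split.
    apply/span_subvP => M; rewrite !inE => /orP[]/eqP->.
      by rewrite -schur_power1.
    exact: (inU 0%N).
  suff /eqP->: free [:: E; J] by [].
  by rewrite free_cons span_seq1 EJ seq1_free.
have := inU 2%N; rewrite UE span_cons span_seq1.
case/memv_addP=> _ /vlineP[beta ->] [_ /vlineP[alpha ->] sqE].
have Esq x y : E x y ^+ 2 = beta * E x y + alpha.
  by move/matrixP/(_ x y): sqE; rewrite schur_powerE !mxE mulr1.
have [/existsP[x /existsP[y xy]]|] :=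
    boolP [exists x, [exists y, E ord0 ord0 != E x y]]; last first.
  rewrite negb_exists => /forallP E_const; case/vlineP: EJ.
  exists (E ord0 ord0); apply/matrixP => x y; rewrite !mxE mulr1.
  have := E_const x; rewrite negb_exists => /forallP/(_ y).
  by rewrite negbK => /eqP.
exists (E ord0 ord0), (E x y); split=> //; try by do 2!eexists.
move=> z t; move: xy (Esq ord0 ord0) (Esq x y) (Esq z t); rewrite -subr_eq0.
move: (E ord0 ord0) (E x y) (E z t) => a b c ab sa sb sc.
(* Subtracting the equations of [a] and [b] identifies them as the two roots, with sum [beta]; any
   further entry [c] is one of them. *)
have /eqP: (a - b) * (a + b - beta) = 0 by nra.
rewrite mulf_eq0 (negPf ab) /= => /eqP abE.
have /eqP: (c - a) * (c - b) = 0 by nra.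
by rewrite mulf_eq0 !subr_eq0 => /orP[]/eqP->; [left|right].
Qed.

End TwoValued.


(** * From block matrices to idempotents and back *)

Section BlocksAndIdempotents.

Variables (R : realType) (n : nat).
Let v := n.+1.
Let J : 'M[R]_v := allones R v.

(** With [K] the matrix of [g], [K / s] projects onto the vectors constant on blocks and [J / v]
    onto the constant ones, so [E] is a projection of rank [(m + 1) - 1]. *)
Lemma idempotent_of_blocks (m s : nat) (g : 'I_v -> 'I_m.+1) :
  (1 <= m)%N -> v = (m.+1 * s)%N -> (forall c, #|[set x | g x == c]| = s) ->
  let E := s%:R^-1 *: fibre_mx R g + (- v%:R^-1) *: J in
  [/\ E *m E = E, \rank E = m, E *m J = 0 &
      has_dim (in_family_span (schur_power E)) 2].
Proof.
move=> m_ge1 v_eq fibc E.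
have fib x : #|[set y | g x == g y]| = s.
  by rewrite -(fibc (g x)); apply: eq_card => y; rewrite !inE eq_sym.
have s_gt0 : (0 < s)%N by move: (ltn0Sn n); rewrite -/v v_eq muln_gt0 => /andP[].
have s_neq0 : s%:R != 0 :> R by rewrite pnatr_eq0 -lt0n.
have v_neq0 : v%:R != 0 :> R by rewrite pnatr_eq0.
have JJ : J *m J = v%:R *: J.
  apply/matrixP => x y; rewrite !mxE mulr1 -[v in RHS]card_ord -sumr_const.
  by apply: eq_bigr => z _; rewrite !mxE mulr1.
have KJ := fibre_mx_allones R fib; have JK := allones_fibre_mx R fib.
have KK := fibre_mx_sqr R fib.
have EJ : E *m J = 0.
  rewrite mulmxDl -!scalemxAl KJ JJ !scalerA mulVf // mulNr mulVf //.
  by rewrite scale1r scaleN1r subrr.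
have EE : E *m E = E.
  rewrite {2}/E mulmxDr -!scalemxAr EJ scaler0 addr0 /E mulmxDl -!scalemxAl.
  rewrite KK JK !scalerA mulVf // scale1r scalerDr scalerA.
  by rewrite mulrCA mulVf ?mulr1.
split=> //.
  (* The rank is the trace, [v / s - 1 = m]. *)
  apply/eqP; rewrite -(eqr_nat R) -(idempotent_rank EE) /E linearD !linearZ /=.
  have -> : \tr (fibre_mx R g) = v%:R.
    rewrite -[v in RHS]card_ord -sumr_const.
    by apply: eq_bigr => x _; rewrite mxE eqxx.
  have -> : \tr J = v%:R.
    by rewrite -[v in RHS]card_ord -sumr_const; apply: eq_bigr => x _; rewrite mxE.
  rewrite mulNr mulVf // {1}v_eq natrM mulrC mulfK // -natr1.
  by apply/eqP; ring.
have EE' x y : E x y = s%:R^-1 * (g x == g y)%:R - v%:R^-1.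
  by rewrite !mxE mulr1.
have g_onto c : exists x, g x = c.
  have /card_gt0P[x] : (0 < #|[set x | g x == c]|)%N by rewrite fibc.
  by rewrite inE => /eqP; exists x.
(* As [m >= 1], the first and last labels differ, so the value off the blocks does occur. *)
have [x gx] := g_onto ord0; have [y gy] := g_onto ord_max.
apply/schur_span_dim2P; exists (s%:R^-1 - v%:R^-1), (- v%:R^-1); split.
- by rewrite -subr_eq0 opprK subrK invr_eq0.
- by exists x, x; rewrite EE' eqxx mulr1.
- exists x, y; rewrite EE' gx gy -val_eqE /= eq_sym eqn0Ngt m_ge1.
  by rewrite mulr0 add0r.
- move=> z t; rewrite EE'; case: eqP => _; rewrite ?mulr1 ?mulr0 ?add0r.
    by left.
  by right.
Qed.

(* As rows sum to zero, each row contains the entry [a] equally often, so the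
   diagonal, which holds the squared row norms, is constant. *)
Lemma blocks_of_idempotent (m : nat) (E : 'M[R]_v) :
  (1 <= m)%N -> E^T = E -> E *m E = E -> \rank E = m -> E *m J = 0 ->
  has_dim (in_family_span (schur_power E)) 2 ->
  exists2 K, similar_to_block_ones m.+1 K &
    exists a b, K = a *: E + b *: J.
Proof.
move=> m_ge1 E_sym EE rkE EJ /schur_span_dim2P[a0 [b0 [ab0 _ _ E0]]].
set a := E ord0 ord0.
have [b ab Eab] : exists2 b, a != b & forall x y, E x y = a \/ E x y = b.
  have [aE|aE] := E0 ord0 ord0; rewrite /a aE; first by exists b0.
  by exists a0; [rewrite eq_sym | move=> x y; case: (E0 x y); [right|left]].
have {}ab : a - b != 0 by rewrite subr_eq0.
pose c x := #|[set y | E x y == a]|.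
(* Used with [h] the identity for row sums and with squaring for row norms. *)
have sumE (h : R -> R) x :
    \sum_y h (E x y) = (c x)%:R * (h a - h b) + v%:R * h b.
  rewrite -sum_indicator mulr_suml.
  have -> : v%:R * h b = \sum_(y < v) h b.
    by rewrite sumr_const card_ord mulr_natl.
  rewrite -big_split /=; apply: eq_bigr => y _.
  case: eqP => [->|neq]; first by rewrite mul1r subrK.
  by case: (Eab x y) => // ->; rewrite mul0r add0r.
have rowsum x : (c x)%:R * (a - b) + v%:R * b = 0.
  move/matrixP/(_ x ord0): EJ; rewrite [X in _ = X]mxE => <-.
  rewrite -(sumE id) mxE; apply: eq_bigr => y _.
  by rewrite !mxE mulr1.
have cE x : (c x)%:R = - (v%:R * b) / (a - b).
  by apply: (mulIf ab); rewrite mulfVK //; have := rowsum x; lra.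
(* As [E] is symmetric and idempotent, it is the Gram matrix of its own rows. *)
have dotE x y : \sum_z E x z * E y z = E x y.
  rewrite -[in RHS]EE mxE; apply: eq_bigr => z _.
  by congr (_ * _); rewrite -{1}E_sym mxE.
have diag0 x : E x x = (c x)%:R * (a ^+ 2 - b ^+ 2) + v%:R * b ^+ 2.
  by rewrite -(sumE (fun z => z ^+ 2)) -{1}dotE; apply: eq_bigr.
have diag x : E x x = a by rewrite /a !diag0 !cE.
pose f x := row x E.
have fE x y : (f x == f y) = (E x y == a).
  apply/eqP/eqP => [/rowP/(_ y)|Exy]; first by rewrite !mxE diag.
  apply/rowP => z; rewrite !mxE; apply/eqP; rewrite -subr_eq0 -sqrf_eq0; apply/eqP.
  apply: (@psumr_eq0P _ _ xpredT (fun z => (E x z - E y z) ^+ 2)) => // [t _|].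
    exact: sqr_ge0.
  (* The squared distance of rows [x] and [y] is [a + a - 2 * a = 0]. *)
  transitivity (\sum_z (E x z * E x z + E y z * E y z - 2 * (E x z * E y z))).
    by apply: eq_bigr => t _; ring.
  by rewrite big_split big_split /= sumrN -mulr_sumr !dotE !diag Exy; ring.
set s := c ord0.
have fib x : #|[set y | f x == f y]| = s.
  have -> : #|[set y | f x == f y]| = c x.
    by apply: eq_card => y; rewrite !inE fE.
  by apply/eqP; rewrite -(eqr_nat R) !cE.
have tra : v%:R * a = m%:R.
  rewrite -rkE -(idempotent_rank EE) mulr_natl -[v in LHS]card_ord -sumr_const.
  by apply: eq_bigr => x _; rewrite diag.
have a_neq0 : a != 0.
  apply: contraTneq m_ge1 => a0'; move/eqP: tra; rewrite a0' mulr0 eq_sym.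
  by rewrite pnatr_eq0 -leqNgt => /eqP->.
have v_eq : v = (m.+1 * s)%N.
  (* Eliminating [s] between the row sum and the row norm gives [a = - a * v * b], so [v * b = -1]
     and [s * (a - b) = 1]. Hence [v = s * (v * a - v * b) = s * (m + 1)]. *)
  have := rowsum ord0; have := diag0 ord0; rewrite -/s -/a => aE sE.
  have /(mulfI a_neq0) vb : a * (v%:R * b) = a * -1 by nra.
  have sab : s%:R * (a - b) = 1 by lra.
  apply/eqP; rewrite -(eqr_nat R) natrM -natr1 -tra; apply/eqP.
  transitivity (v%:R * (s%:R * (a - b))); first by rewrite sab mulr1.
  transitivity (s%:R * (v%:R * a) - s%:R * (v%:R * b)); first by ring.
  by rewrite vb; ring.
exists (fibre_mx R f); last first.
  (* The affine function sending [a] to 1 and [b] to 0. *)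
  exists (a - b)^-1, (- b / (a - b)); apply/matrixP => x y.
  rewrite !mxE fE mulr1; case: eqP => [->|neq] /=; first by field.
  by case: (Eab x y) => // ->; field.
have [||g gE gfib] := fibre_labels (k := m.+1) _ fib; rewrite ?card_ord //.
apply/similar_to_block_onesP.
have -> : (v %/ m.+1)%N = s by rewrite v_eq mulKn.
split=> //; exists g => //.
by apply/matrixP => x y; rewrite !mxE gE.
Qed.

End BlocksAndIdempotents.

(** * The equitable partition, and the equivalence assembled *)

(* [A K = K A]: the entry at [(x, y)] counts the neighbours of [x] in the cell
   of [y] on the left, and on the right depends on [x] only through its cell. *)
Lemma fibres_equitable (R : realType) (n : nat) (e : rel 'I_n.+1) (T : eqType)
    (g : 'I_n.+1 -> T) :
  adjmx R e *m fibre_mx R g = fibre_mx R g *m adjmx R e ->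
  equitable e (fibres g).
Proof.
move=> comm; split; first exact: fibres_partition.
move=> _ _ /imsetP[z _ ->] /imsetP[t _ ->] x y; rewrite !inE => /eqP zx /eqP zy.
have AK u : (#|[set w in [set w | g t == g w] | e u w]|)%:R =
    (adjmx R e *m fibre_mx R g) u t.
  rewrite mxE -sum_indicator; apply: eq_bigr => w _.
  by rewrite !mxE inE -natrM mulnb andbC [g w == _]eq_sym.
apply/eqP; rewrite -(eqr_nat R) !AK comm !mxE; apply/eqP; apply: eq_bigr => w _.
by rewrite !mxE -zx -zy.
Qed.

Lemma col_fibre_mx (R : realType) (n : nat) (T : eqType) (g : 'I_n -> T) j :
  col j (fibre_mx R g) = char_vec R [set y | g j == g y].
Proof. by apply/colP => x; rewrite !mxE inE eq_sym. Qed.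

Theorem proposition3p2 (R : realType) (v : nat) (e : rel 'I_v) (m : nat)
    (e_simple : simple_graph e) (e_connected : connected_graph e)
    (e_regular : regular_graph e) (m_ge1 : (1 <= m)%N) :
  ((exists K : 'M[R]_v,
      in_adjacency_algebra e K /\ similar_to_block_ones m.+1 K)
   <->
   (exists E : 'M[R]_v,
      [/\ in_adjacency_algebra e E,
          E *m E = E,
          \rank E = m,
          E *m allones R v = 0 &
          has_dim (in_family_span (schur_power E)) 2]))
  /\
  (forall K : 'M[R]_v,
     in_adjacency_algebra e K -> similar_to_block_ones m.+1 K ->
     exists P : {set {set 'I_v}},
       [/\ equitable e P,
           #|P| = m.+1,
           (forall C D : {set 'I_v}, C \in P -> D \in P -> #|C| = #|D|) &
           (forall c : 'cV[R]_v,
              (exists j : 'I_v, c = col j K) <->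
              (exists2 C : {set 'I_v}, C \in P & c = char_vec R C))]).
Proof.
(* Connectedness rules out the empty graph. *)
case: v e e_simple e_connected e_regular => [|n] e [e_sym _] e_conn e_reg.
  by case: e_conn.
have J_alg := allones_in_adjacency_algebra R e_sym e_conn e_reg.
split; first split.
- move=> [K [K_alg /similar_to_block_onesP[v_eq [g fib KE]]]].
  have [EE rkE EJ dimE] := idempotent_of_blocks R m_ge1 (esym v_eq) fib.
  eexists; split; [|exact: EE|exact: rkE|exact: EJ|exact: dimE].
  by apply: in_adjacency_algebra_lin; rewrite -?KE.
- move=> [E [E_alg EE rkE EJ dimE]].
  have E_sym := in_adjacency_algebra_tr e_sym E_alg.
  have [K K_blk [a [b KE]]] := blocks_of_idempotent m_ge1 E_sym EE rkE EJ dimE.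
  by exists K; split=> //; rewrite KE; apply: in_adjacency_algebra_lin.
move=> K K_alg /similar_to_block_onesP[v_eq [g fibc KE]].
have fib x : #|[set y | g x == g y]| = (n.+1 %/ m.+1)%N.
  by rewrite -(fibc (g x)); apply: eq_card => y; rewrite !inE eq_sym.
exists (fibres g); split.
- apply: (@fibres_equitable R); rewrite -KE.
  exact: in_adjacency_algebra_comm.
- by apply: card_fibres_eq fib _; rewrite card_ord.
- by move=> _ _ /imsetP[x _ ->] /imsetP[y _ ->]; rewrite !fib.
- move=> c; split=> [[j ->]|[_ /imsetP[j _ ->] ->]].
    by exists [set y | g j == g y]; [apply: imset_f|rewrite KE col_fibre_mx].
  by exists j; rewrite KE col_fibre_mx.
Qed.
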